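(* Let $H$ be a complex Hilbert space. Then there are sequences $(\lambda_n)_{n=0}^\infty$ and $(u_n)_{n=0}^\infty$ of mappings such that the following properties are fulfilled for every integer $n\ge 0$ and every $x\in K(H)$: (a) $\lambda_n:K(H)\to[0,\infty)$ is a lower semicontinuous mapping; (b) $\lambda_{n+1}(x)<\lambda_n(x)$ whenever $\lambda_n(x)>0$; (c) $u_n:K(H)\to K(H)$ is a Borel measurable mapping; (d) $u_n(x)$ is a finite rank partial isometry on $H$; (e) $u_n(x)=0$ whenever $\lambda_n(x)=0$; (f) the partial isometries $u_k(x)$, $k\in\mathbb N\cup\{0\}$, are pairwise orthogonal; (g) $x=\sum_{n=0}^\infty\lambda_n(x)u_n(x)$, where the series converges in the operator norm.
   Context: $K(H)$ is the C$^*$-algebra of compact operators on $H$ with the operator norm; semicontinuity and Borel measurability are with respect to the norm topology. $H$ is not assumed separable. Two partial isometries $u,v$ are orthogonal if $u^*v=0$ and $uv^*=0$ (equivalently, their initial projections are orthogonal and their final projections are orthogonal). *)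

(* Defs.v *)
From HB Require Import structures.
From mathcomp Require Import all_boot all_order all_algebra complex.
From mathcomp Require Import all_classical all_reals all_analysis.

Set Implicit Arguments.
Unset Strict Implicit.
Unset Printing Implicit Defensive.

Import Order.TTheory GRing.Theory Num.Theory.
Import numFieldNormedType.Exports.

Local Open Scope classical_set_scope.
Local Open Scope ring_scope.
Local Open Scope complex_scope.

(* The inner product is linear in its first argument and conjugate-linear in
   the second one. *)
HB.mixin Record NormedModule_isHilbert (R : realType) (H : Type)
    & CompleteNormedModule R[i] H := {
  inner : {dot H for Num.conj} ;
  inner_norm : forall x : H, inner x x = `|x| ^+ 2
}.

#[short(type="hilbertType")]
HB.structure Definition Hilbert (R : realType) :=
  {H of CompleteNormedModule R[i] H & NormedModule_isHilbert R H}.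

Section compact_operators.
Context {R : realType} {H : normedModType R[i]}.
Implicit Types S T : H -> H.

Definition unit_ball : set H := [set x | `|x| <= 1].

Definition compact_operator T :=
  linear T /\ compact (closure (T @` unit_ball)).

Definition compop_pred : {pred (H -> H)} := fun T => `[< compact_operator T >].

Lemma compact_operator_submod : GRing.submod_closed compop_pred.
Proof.
split.
  apply/asboolP; split; first by move=> a x y; rewrite -[RHS]/(a *: (0 : H) + 0) scaler0 addr0.
  apply: (@subclosed_compact _ _ [set 0]); [exact: closed_closure|exact: compact_set1|].
  rewrite closureE; apply: smallest_sub; last by move=> _ [x _ <-].
  by apply: compact_closed; [exact: norm_hausdorff|exact: compact_set1].
move=> a S T /asboolP[lS cS] /asboolP[lT cT]; apply/asboolP; split.
  move=> b x y.
  rewrite -[LHS]/(a *: S (b *: x + y) + T (b *: x + y)).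
  rewrite -[RHS]/(b *: (a *: S x + T x) + (a *: S y + T y)).
  by rewrite lS lT !scalerDr !scalerA (mulrC b) addrACA.
pose f (p : H * H) := a *: p.1 + p.2.
have cf : continuous f.
  move=> p; apply: cvgD; last exact: cvg_snd.
  by apply: cvgZr; exact: cvg_fst.
pose K := f @` (closure (S @` unit_ball) `*` closure (T @` unit_ball)).
have cK : compact K.
  apply: continuous_compact; last exact: compact_setX.
  exact: continuous_subspaceT.
apply: (@subclosed_compact _ _ K) => //; first exact: closed_closure.
rewrite closureE; apply: smallest_sub.
  by apply: compact_closed => //; exact: norm_hausdorff.
move=> _ [x Bx <-]; exists (S x, T x) => //=.
by split; apply: subset_closure; exists x.
Qed.

End compact_operators.
Arguments compop_pred {R} H.

HB.instance Definition _ (R : realType) (H : normedModType R[i]) :=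
  GRing.isSubmodClosed.Build R[i] (H -> H) (compop_pred H)
    compact_operator_submod.

Record compop (R : realType) (H : normedModType R[i]) := Compop {
  compop_val :> H -> H ;
  compop_valP : compop_val \in compop_pred H
}.

HB.instance Definition _ (R : realType) (H : normedModType R[i]) :=
  [isSub for @compop_val R H].
HB.instance Definition _ (R : realType) (H : normedModType R[i]) :=
  [Choice of compop H by <:].
HB.instance Definition _ (R : realType) (H : normedModType R[i]) :=
  [SubChoice_isSubLmodule of compop H by <:].

Section operator_norm.
Context {R : realType} {H : normedModType R[i]}.
Implicit Types S T : compop H.

Definition opnorm T : R := sup [set complex.Re `|T x| | x in unit_ball].

Lemma ReK (x : H) : (complex.Re `|x|)%:C = `|x|.
Proof. by rewrite RRe_real. Qed.

Lemma Re_norm_le (x y : H) : (complex.Re `|x| <= complex.Re `|y|) = (`|x| <= `|y|).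
Proof. by rewrite -lecR !ReK. Qed.

Lemma compop_linear T : linear T.
Proof. by have /asboolP[] := compop_valP T. Qed.

Lemma compop_compact T : compact (closure (T @` unit_ball)).
Proof. by have /asboolP[] := compop_valP T. Qed.

Lemma compop0 T : T 0 = 0.
Proof.
have := compop_linear T (-1) 0 0; rewrite scaler0 addr0 => e.
by rewrite e scaleN1r addNr.
Qed.

Lemma compopZ T a x : T (a *: x) = a *: T x.
Proof. by have := compop_linear T a x 0; rewrite addr0 compop0 addr0. Qed.

Lemma opnorm_has_sup T : has_sup [set complex.Re `|T x| | x in unit_ball].
Proof.
split; first by exists (complex.Re `|T 0|), 0 => //; rewrite /unit_ball/= normr0.
pose U (n : nat) : set H := [set p | `|p| < n%:R].
have oU n : open (U n).
  rewrite openE => p; rewrite /U /= -subr_gt0 => ltpn.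
  apply/nbhs_ballP; exists (n%:R - `|p|) => // q.
  rewrite -ball_normE /= ltrBrDr distrC; apply: le_lt_trans.
  by rewrite -{1}(subrK p q) ler_normD.
have cU : closure (T @` unit_ball) `<=` \bigcup_(n in setT) U n.
  move=> p _; exists (Num.truncn (complex.Re `|p|)).+1 => //.
  by rewrite /U /= -ReK -(rmorph_nat (real_complex R)) ltcR truncnS_gt.
have : compact (closure (T @` unit_ball)) by exact: compop_compact.
rewrite compact_cover => /(_ _ setT U (fun n _ => oU n) cU)[D _ DU].
exists (\sum_(i <- finmap.enum_fset D) i%:R) => _ [x Bx <-].
have [n Dn] := DU _ (subset_closure (imageP T Bx)).
rewrite /U /= -ReK -(rmorph_nat (real_complex R)) ltcR => /ltW/le_trans; apply.
by rewrite (big_rem n)//= lerDl sumr_ge0.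
Qed.

Lemma opnorm_ub T x : `|x| <= 1 -> complex.Re `|T x| <= opnorm T.
Proof.
by move=> x1; apply: ub_le_sup; [have [] := opnorm_has_sup T|exists x].
Qed.

Lemma opnorm_le T (M : R) :
  (forall x, `|x| <= 1 -> complex.Re `|T x| <= M) -> opnorm T <= M.
Proof.
move=> h; apply: ge_sup; first by have [] := opnorm_has_sup T.
by move=> _ [x x1 <-]; exact: h.
Qed.

Lemma opnorm_ge0 T : 0 <= opnorm T.
Proof.
have := @opnorm_ub T 0; rewrite normr0 => /(_ ler01); apply: le_trans.
by rewrite -lecR ReK; exact: normr_ge0.
Qed.

Lemma opnorm_triangle S T : (opnorm (S + T))%:C <= (opnorm S)%:C + (opnorm T)%:C.
Proof.
rewrite -rmorphD lecR; apply: opnorm_le => x x1.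
rewrite (le_trans _ (lerD (opnorm_ub S x1) (opnorm_ub T x1)))//.
by rewrite -lecR rmorphD /= !ReK ler_normD.
Qed.

Lemma opnormZ_le a T : (opnorm (a *: T))%:C <= `|a| * (opnorm T)%:C.
Proof.
have aE : (complex.Re `|a|)%:C = `|a| by rewrite RRe_real.
rewrite -aE -rmorphM lecR; apply: opnorm_le => x x1.
rewrite -lecR rmorphM /= ReK aE normrZ ler_wpM2l// -ReK lecR.
exact: opnorm_ub.
Qed.

Lemma opnormZ a T : (opnorm (a *: T))%:C = `|a| * (opnorm T)%:C.
Proof.
apply/le_anti; rewrite opnormZ_le /=.
have [->|a0] := eqVneq a 0.
  by rewrite normr0 mul0r ler0c opnorm_ge0.
rewrite -ler_pdivlMl ?normr_gt0// -normfV.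
by rewrite -{1}[T]scale1r -(mulVf a0) -scalerA opnormZ_le.
Qed.

Lemma opnorm_eq0 T : (opnorm T)%:C = 0 -> T = 0.
Proof.
move=> [T0]; apply/val_inj/funext => x /=; change (T x = 0).
have [->|x0] := eqVneq x 0; first exact: compop0.
have nx : `|x| \is a GRing.unit by rewrite unitfE normr_eq0.
rewrite -[x](scalerKV nx) compopZ.
suff -> : T (`|x|^-1 *: x) = 0 by rewrite scaler0.
have x1 : `|(`|x|^-1 *: x)| <= 1 by rewrite normrZ normfV normr_id mulVr.
by have := opnorm_ub T x1; rewrite T0 -lecR ReK normr_le0 => /eqP.
Qed.

End operator_norm.

HB.instance Definition _ (R : realType) (H : normedModType R[i]) :=
  Lmodule_isNormed.Build R[i] (compop H)
    opnorm_triangle opnormZ opnorm_eq0.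

Definition borel (T : ptopologicalType) := g_sigma_algebraType (@open T).

Section operators_on_Hilbert_space.
Context {R : realType} {H : hilbertType R}.
Implicit Types u v : H -> H.

(* The set below has at most one element (see [adjointE]); for a bounded
   operator [u] it is nonempty by the Riesz representation theorem. *)
Definition adjoint u : H -> H :=
  xget 0 [set w : H -> H | forall x y, inner (u x) y = inner x (w y)].

Lemma adjointE u w :
  (forall x y, inner (u x) y = inner x (w y)) -> adjoint u = w.
Proof.
move=> uw; apply: xget_unique => // w' uw'; apply/funext => y; apply/eqP.
rewrite -subr_eq0 -normr_eq0 -sqrf_eq0 -inner_norm raddfB /=.
by rewrite -uw' -uw subrr.
Qed.

Definition partial_isometry u :=
  forall x, (forall y, u y = 0 -> inner x y = 0) -> `|u x| = `|x|.

Definition finite_rank u :=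
  exists s : seq H, forall x, exists c : 'I_(size s) -> R[i],
    u x = \sum_(i < size s) c i *: s`_i.

Definition orthogonal_operators u v :=
  adjoint u \o v = 0 /\ u \o adjoint v = 0.

End operators_on_Hilbert_space.

(* Main.v *)
(* The vectors at which a compact operator [x] attains its norm form a subspace
   [top_space x], finite-dimensional if [x <> 0], with orthogonal projection
   [top_proj x]; on it [x] is [opnorm x] times an isometry.  Removing this part,
   [deflate x = x (1 - top_proj x)], strictly decreases the norm, and iterating
   gives the distinct singular values [sing_val n x] of [x] together with their
   partial isometries.  Compactness forbids infinitely many orthogonal vectors
   [x v_n] bounded away from [0], so the remainders tend to [0].
   Lower semicontinuity is a Weyl-type inequality: a unit vector of the n-th
   singular space of [x] is an approximate eigenvector of [y^* y] for [y] near
   [x], and the squared singular values of [y] cannot avoid its eigenvalue.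
   For measurability no simple functions are available, since the space of
   compact operators need not be separable.  Instead, on each closed set where
   [opnorm x - sing_val 1 x] is bounded below, the projection [top_proj x]
   varies continuously (a sin-theta estimate), so that [deflate] and the first
   partial isometry are continuous on countably many closed pieces covering
   everything, hence Borel; the n-th partial isometry is the composition of the
   first one with an iterate of [deflate]. *)
Require Import Defs.
From mathcomp Require Import all_boot all_order all_algebra complex.
From mathcomp Require Import all_classical all_reals all_analysis.
From mathcomp Require Import ring lra.
Import Order.TTheory GRing.Theory Num.Theory.
Import numFieldNormedType.Exports.
Set Implicit Arguments.
Unset Strict Implicit.
Unset Printing Implicit Defensive.
Local Open Scope classical_set_scope.
Local Open Scope ring_scope.
Local Open Scope complex_scope.

(** * The norm and the inner product with real values *)

Lemma complexReD (R : realType) (a b : R[i]) :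
  complex.Re (a + b) = complex.Re a + complex.Re b.
Proof. by case: a b => [? ?] []. Qed.

Lemma complexReN (R : realType) (a : R[i]) : complex.Re (- a) = - complex.Re a.
Proof. by case: a. Qed.

Lemma complexReZ (R : realType) (t : R) (a : R[i]) :
  complex.Re (t%:C * a) = t * complex.Re a.
Proof. by case: a => a b /=; rewrite mul0r subr0. Qed.

Section real_norm.
Context {R : realType} {V : normedModType R[i]}.
Implicit Types x y : V.

(** The norm of [V] takes its values in [R[i]]; its real part carries the same information and lives
    in the ordered field [R], where [lra] and [nra] apply. *)
Definition rnorm x : R := complex.Re `|x|.

Lemma rnormE x : (rnorm x)%:C = `|x|.
Proof. exact: ReK. Qed.

Lemma rnorm_ge0 x : 0 <= rnorm x.
Proof. by rewrite -lecR rnormE normr_ge0. Qed.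

Lemma rnorm0 : rnorm 0 = 0.
Proof. by rewrite /rnorm normr0. Qed.

Lemma rnorm_eq0 x : (rnorm x == 0) = (x == 0).
Proof. by rewrite -[x == 0]normr_eq0 -rnormE (inj_eq (@complexI R)). Qed.

Lemma rnormN x : rnorm (- x) = rnorm x.
Proof. by rewrite /rnorm normrN. Qed.

Lemma rdistC x y : rnorm (x - y) = rnorm (y - x).
Proof. by rewrite /rnorm distrC. Qed.

Lemma rnormD x y : rnorm (x + y) <= rnorm x + rnorm y.
Proof. by rewrite -lecR rmorphD /= !rnormE ler_normD. Qed.

Lemma rnormB x y : rnorm (x - y) <= rnorm x + rnorm y.
Proof. by rewrite -(rnormN y) rnormD. Qed.

Lemma rnorm_dist x y : rnorm x - rnorm y <= rnorm (x - y).
Proof. by rewrite lerBlDr -{1}(subrK y x) rnormD. Qed.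

Lemma rnormZ (a : R[i]) x : rnorm (a *: x) = complex.Re `|a| * rnorm x.
Proof.
apply: (@complexI R); rewrite rnormE normrZ -(rnormE x).
by rewrite -{1}(RRe_real (normr_real a)) -rmorphM.
Qed.

Lemma rnormZr (t : R) x : rnorm (t%:C *: x) = `|t| * rnorm x.
Proof. by rewrite rnormZ normc_def /= expr0n addr0 sqrtr_sqr. Qed.

Lemma rnorm_normalize x : x != 0 -> rnorm ((rnorm x)^-1%:C *: x) = 1.
Proof.
rewrite -rnorm_eq0 => x0.
by rewrite rnormZr ger0_norm ?invr_ge0 ?rnorm_ge0// mulVf.
Qed.

Lemma near_rnorm x (e : R) : 0 < e -> \forall y \near x, rnorm (x - y) < e.
Proof.
move=> e0; apply/nbhs_ballP; exists e%:C; first by rewrite /= ltcR.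
by move=> y; rewrite -ball_normE /= -rnormE ltcR.
Qed.

Lemma cvg_rnormP {T : Type} {F : set_system T} {FF : Filter F} (f : T -> V) x :
  (forall e : R, 0 < e -> \forall t \near F, rnorm (x - f t) < e) -> f @ F --> x.
Proof.
move=> h; apply/cvgrPdist_lt => e e0.
have [eR e0'] : e = (complex.Re e)%:C /\ 0 < complex.Re e.
  have eE : e = (complex.Re e)%:C by rewrite RRe_real// gtr0_real.
  by split=> //; rewrite -ltcR -eE.
apply: filterS (h _ e0') => t; rewrite -ltcR rnormE => ht.
by rewrite (lt_le_trans ht)// -eR.
Qed.

End real_norm.

Section real_inner_product.
Context {R : realType} {H : hilbertType R}.
Implicit Types x y z : H.

Definition rip x y : R := complex.Re (inner x y).

Lemma ripC x y : rip x y = rip y x.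
Proof.
rewrite /rip (hermC _ x y) expr0 mul1r /=.
by case: (inner y x).
Qed.

Lemma ripDl x y z : rip (x + y) z = rip x z + rip y z.
Proof. by rewrite /rip linearDl complexReD. Qed.

Lemma ripDr x y z : rip z (x + y) = rip z x + rip z y.
Proof. by rewrite ripC ripDl !(ripC z). Qed.

Lemma ripNl x z : rip (- x) z = - rip x z.
Proof. by rewrite /rip linearNl complexReN. Qed.

Lemma ripNr x z : rip z (- x) = - rip z x.
Proof. by rewrite ripC ripNl ripC. Qed.

Lemma rip0l z : rip 0 z = 0.
Proof. by rewrite /rip linear0l. Qed.

Lemma rip0r z : rip z 0 = 0.
Proof. by rewrite ripC rip0l. Qed.

Lemma ripZl (t : R) x z : rip (t%:C *: x) z = t * rip x z.
Proof. by rewrite /rip linearZl_LR complexReZ. Qed.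

Lemma ripZr (t : R) x z : rip z (t%:C *: x) = t * rip z x.
Proof. by rewrite ripC ripZl ripC. Qed.

Lemma ripxx x : rip x x = rnorm x ^+ 2.
Proof. by rewrite /rip inner_norm -rnormE -rmorphXn. Qed.

Lemma rnormD2 x y : rnorm (x + y) ^+ 2 = rnorm x ^+ 2 + 2 * rip x y + rnorm y ^+ 2.
Proof. by rewrite -!ripxx !(ripDl, ripDr) (ripC y x); ring. Qed.

Lemma rnormB2 x y : rnorm (x - y) ^+ 2 = rnorm x ^+ 2 - 2 * rip x y + rnorm y ^+ 2.
Proof. by rewrite rnormD2 ripNr rnormN; ring. Qed.

(** Cauchy-Schwarz, by expanding the squared norm of [(rnorm y) x - (rnorm x) y]. *)
Lemma rip_le x y : rip x y <= rnorm x * rnorm y.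
Proof.
have [->|x0] := eqVneq x 0; first by rewrite rip0l rnorm0 mul0r.
have [->|y0] := eqVneq y 0; first by rewrite rip0r rnorm0 mulr0.
have nx0 : 0 < rnorm x by rewrite lt_neqAle rnorm_ge0 eq_sym rnorm_eq0 x0.
have ny0 : 0 < rnorm y by rewrite lt_neqAle rnorm_ge0 eq_sym rnorm_eq0 y0.
have := sqr_ge0 (rnorm ((rnorm y)%:C *: x - (rnorm x)%:C *: y)).
rewrite rnormB2 !rnormZr ripZl ripZr !ger0_norm ?rnorm_ge0//.
move=> h; rewrite -(ler_pM2l (mulr_gt0 nx0 ny0)).
nra.
Qed.

Lemma rip_norm_le x y : `|rip x y| <= rnorm x * rnorm y.
Proof.
by rewrite ler_norml rip_le lerNl -ripNl -(rnormN x) rip_le.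
Qed.

End real_inner_product.

(** * Norm attainment and finiteness from compactness *)

Section compact_operator_norm.
Context {R : realType} {H : hilbertType R}.
Implicit Types (x y : compop H) (v w : H).

Lemma compopD x v w : x (v + w) = x v + x w.
Proof. by have := compop_linear x 1 v w; rewrite !scale1r. Qed.

Lemma compopN x v : x (- v) = - x v.
Proof. by rewrite -scaleN1r compopZ scaleN1r. Qed.

Lemma compopB x v w : x (v - w) = x v - x w.
Proof. by rewrite compopD compopN. Qed.

Lemma compop_sum x I (s : seq I) (c : I -> R[i]) (f : I -> H) :
  x (\sum_(i <- s) c i *: f i) = \sum_(i <- s) c i *: x (f i).
Proof.
elim: s => [|i s IH]; first by rewrite !big_nil compop0.
by rewrite !big_cons compopD compopZ IH.
Qed.

Lemma rnorm_compop x : rnorm x = opnorm x.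
Proof. by []. Qed.

Lemma opnorm0 : opnorm (0 : compop H) = 0.
Proof. by rewrite -rnorm_compop rnorm0. Qed.

Lemma opnorm_eq0P x : (opnorm x == 0) = (x == 0).
Proof. by rewrite -rnorm_compop rnorm_eq0. Qed.

Lemma opnorm_gt0 x : (0 < opnorm x) = (x != 0).
Proof. by rewrite lt_neqAle opnorm_ge0 andbT eq_sym opnorm_eq0P. Qed.

Lemma unit_ballP v : unit_ball v <-> rnorm v <= 1.
Proof. by rewrite /unit_ball /= -rnormE -lecR. Qed.

Lemma rnorm_compop_le x v : rnorm (x v) <= opnorm x * rnorm v.
Proof.
have [->|v0] := eqVneq v 0; first by rewrite compop0 !rnorm0 mulr0.
have nv : 0 < rnorm v by rewrite lt_neqAle rnorm_ge0 eq_sym rnorm_eq0 v0.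
have := @opnorm_ub _ _ x ((rnorm v)^-1%:C *: v).
rewrite -rnormE rnorm_normalize// => /(_ (lexx _)).
rewrite compopZ -/(rnorm _) rnormZr ger0_norm ?invr_ge0 ?rnorm_ge0//.
by rewrite mulrC ler_pdivrMr.
Qed.

Lemma opnorm_le_bound x (M : R) : 0 <= M ->
  (forall v, rnorm (x v) <= M * rnorm v) -> opnorm x <= M.
Proof.
move=> M0 h; apply: opnorm_le => v /unit_ballP v1.
by rewrite (le_trans (h v))// ler_piMr.
Qed.

(** The norm attains its maximum on the compact closure of the image of the unit ball. The maximizer
    [z] is so far only a limit of values of [x]. *)
Lemma compact_opnorm_limit x : exists2 z : H, opnorm x <= rnorm z &
  forall d : R, 0 < d -> exists2 v, rnorm v <= 1 & rnorm (x v - z) < d.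
Proof.
have cK : compact (closure (x @` unit_ball)) by exact: compop_compact.
have [||z + zmax] := compact_EVT_max _ cK (f := @rnorm R H).
- exists (x 0); apply: subset_closure; exists 0 => //.
  by apply/unit_ballP; rewrite rnorm0.
- apply: continuous_subspaceT => v; apply/cvgrPdist_lt => e e0.
  near=> w; have : rnorm (v - w) < e by near: w; exact: near_rnorm.
  apply: le_lt_trans; rewrite ler_norml rnorm_dist andbT.
  by rewrite lerNl opprB rdistC rnorm_dist.
rewrite inE => zK; exists z.
  apply: opnorm_le => v v1; apply: zmax; rewrite inE.
  by apply: subset_closure; exists v.
move=> d d0; have [_ [[v /unit_ballP v1 <-] zv]] := zK _ (near_rnorm z d0).
by exists v; rewrite // rdistC.
Unshelve. all: by end_near. Qed.

(* By the parallelogram law, approximate maximizers of [rnorm (x v)] on the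
   unit ball whose images are close to each other are themselves close. *)
Lemma opnorm_attained x : 0 < opnorm x ->
  exists2 v, rnorm v = 1 & rnorm (x v) = opnorm x.
Proof.
move=> x0; set l := opnorm x in x0 *.
have [z lz zlim] := compact_opnorm_limit x; rewrite -/l in lz.
pose A (d : R) : set H := [set v | rnorm v <= 1 /\ rnorm (x v - z) < d].
pose F := filter_from [set d : R | 0 < d] A.
have FF : ProperFilter F.
  apply: filter_from_proper; last by move=> d /zlim[v v1 vd]; exists v.
  apply: filter_from_filter; first by exists 1 => /=.
  move=> d1 d2 /= d10 d20; exists (Num.min d1 d2) => /=.
    by rewrite lt_min d10.
  by move=> v [v1]; rewrite lt_min => /andP[].
(* Both images are near [z], so [rnorm (v + w)] is at least [2 - 2 * d / l]; the parallelogram law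
   bounds the square by [4 - (2 - 2 * d / l) ^+ 2], hence by [8 * d / l]. *)
have close d v w : 0 < d -> d < l -> A d v -> A d w ->
    rnorm (v - w) ^+ 2 <= 8 * d / l.
  move=> d0 dl [v1 vd] [w1 wd].
  have h1 : 2 * l - 2 * d <= l * rnorm (v + w).
    apply: le_trans (rnorm_compop_le x (v + w)).
    have h : rnorm (z + z) <= rnorm (x (v + w)) + (rnorm (x v - z) + rnorm (x w - z)).
      rewrite -(lerD2r (- rnorm (x (v + w)))) (addrAC _ _ (- _)) subrr add0r.
      rewrite (le_trans _ (rnormD _ _))// (le_trans (rnorm_dist _ _))//.
      rewrite rdistC compopD le_eqVlt; apply/orP; left; apply/eqP.
      by congr rnorm; rewrite opprD addrACA.
    have zz : rnorm (z + z) = 2 * rnorm z.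
      by rewrite -mulr2n -scaler_nat -(rmorph_nat (real_complex R)) rnormZr normr_nat.
    lra.
  rewrite ler_pdivlMr//.
  have := rnormD2 v w; have := rnormB2 v w.
  have := rnorm_ge0 v; have := rnorm_ge0 w; have := rnorm_ge0 (v + w).
  set a := rnorm (v + w) in h1 *; set b := rnorm (v - w).
  move: (rnorm v) (rnorm w) (rip v w) v1 w1 => p q r p1 q1 a0 q0 p0 e1 e2.
  have b2 : b ^+ 2 <= 4 - a ^+ 2 by nra.
  have a2 : (2 * l - 2 * d) ^+ 2 <= (l * a) ^+ 2.
    by rewrite ler_sqr ?nnegrE//; [lra|apply: mulr_ge0 => //; exact: ltW].
  rewrite -(ler_pM2r x0).
  nra.
have : cvg F.
  apply: cauchy_cvg; apply: cauchy_exP => e e0.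
  have e1 : 0 < complex.Re e by move: e0; rewrite ltcE => /andP[].
  have eE : e = (complex.Re e)%:C by rewrite RRe_real// gtr0_real.
  set r := complex.Re e in e1 eE.
  (* The first bound gives [d < l], the second one [8 * d / l <= r ^+ 2 / 2]. *)
  pose d := Num.min (l / 2) (l * r ^+ 2 / 16).
  have r2 : 0 < r ^+ 2 by rewrite exprn_gt0.
  have d0 : 0 < d by rewrite lt_min !divr_gt0 ?mulr_gt0.
  have dl : d < l by rewrite gt_min; apply/orP; left; lra.
  have [v v1 vd] := zlim _ d0; exists v; exists d => // w Aw.
  rewrite -ball_normE /= eE -rnormE ltcR.
  have := close _ v w d0 dl (conj v1 vd) Aw.
  rewrite -(ltr_sqr (rnorm_ge0 _) (ltW e1)) => /le_lt_trans; apply.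
  have : d <= l * r ^+ 2 / 16 by rewrite ge_min lexx orbT.
  rewrite ltr_pdivrMr//; have := mulr_gt0 x0 r2; lra.
move=> /cvg_ex[v Fv].
have near_v d : 0 < d -> exists2 w, rnorm (v - w) < d & A d w.
  move=> d0; have Fd : F (A d) by exists d.
  have Fvd : F [set w | rnorm (v - w) < d] by exact: Fv (near_rnorm v d0).
  have FI : F ([set w | rnorm (v - w) < d] `&` A d) by exact: filterI.
  have [w [vw Aw]] := filter_ex FI.
  by exists w.
have v1 : rnorm v <= 1.
  apply/ler_addgt0Pr => d d0; have [w vw [w1 _]] := near_v _ d0.
  have := rnorm_dist v w; lra.
have xv : l <= rnorm (x v).
  apply/ler_addgt0Pr => e e0.
  have d0 : 0 < e / (l + 1) by rewrite divr_gt0//; lra.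
  have [w vw [w1 xw]] := near_v _ d0.
  have h1 := rnorm_compop_le x (v - w); rewrite compopB -/l in h1.
  have h2 : rnorm z - rnorm (x w) <= rnorm (x w - z) by rewrite rdistC rnorm_dist.
  have h3 : rnorm (x w) - rnorm (x v) <= rnorm (x v - x w).
    by rewrite rdistC rnorm_dist.
  have h4 : l * rnorm (v - w) <= l * (e / (l + 1)) by rewrite ler_pM2l// ltW.
  have h5 : l * (e / (l + 1)) + e / (l + 1) = e by field; lra.
  lra.
have xv' := rnorm_compop_le x v; rewrite -/l in xv'.
have v1' : rnorm v = 1.
  apply/eqP; rewrite eq_le v1 -(ler_pM2l x0) mulr1 (le_trans xv)//.
by exists v => //; apply/eqP; rewrite eq_le xv andbT (le_trans xv')// v1' mulr1.
Qed.

(** Finitely many balls of radius [c / 2] cover the image of the unit ball, and no two of the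
    separated points share a ball; the size of the cover serves as [n]. *)
Lemma compact_separated x (c : R) : 0 < c ->
  exists n : nat, forall (m : nat) (f : nat -> H),
    (forall i, (i < m)%N -> rnorm (f i) <= 1) ->
    (forall i j, (i < j < m)%N -> c <= rnorm (x (f i) - x (f j))) ->
    (m <= n)%N.
Proof.
move=> c0.
pose U (p : H) : set H := ball p (c / 2)%:C.
have c2 : 0 < (c / 2)%:C by rewrite ltcR divr_gt0.
have oU p : setT p -> open (U p) by move=> _; exact: ball_open.
have : compact (closure (x @` unit_ball)) by exact: compop_compact.
rewrite compact_cover => /(_ _ setT U oU)[].
  by move=> p _; exists p => //; exact: ballxx.
move=> D _ DU; pose s := finmap.enum_fset D; exists (size s) => m f f1 fc.
have ex (i : 'I_m) : {p : H | p \in s & rnorm (p - x (f i)) < c / 2}.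
  apply: cid2; have [] := DU (x (f i)).
    by apply: subset_closure; exists (f i) => //; apply/unit_ballP/f1.
  move=> p /= Dp; rewrite /U -ball_normE /= -rnormE ltcR => h.
  by exists p.
pose g i := s2val (ex i).
have gD i : g i \in s by rewrite /g; case: (ex i).
have gf i : rnorm (g i - x (f i)) < c / 2 by rewrite /g; case: (ex i).
have neq (i j : 'I_m) : (i < j)%N -> g i <> g j.
  move=> ij gij; have := fc i j; rewrite ij ltn_ord => /(_ isT).
  have := gf i; have := gf j; rewrite -gij => h1 h2.
  have := rnormD (x (f i) - g i) (g i - x (f j)).
  rewrite addrA subrK (rdistC (x (f i)) (g i)); lra.
have ginj : injective g.
  move=> i j gij; case: (ltngtP i j) => [ij|ji|]; last exact: val_inj.
    by have := neq i j ij gij.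
  by have := neq j i ji (esym gij).
have us : uniq [seq g i | i <- enum 'I_m] by rewrite map_inj_uniq ?enum_uniq.
have := uniq_leq_size us (s2 := s); rewrite size_map size_enum_ord; apply.
by move=> p /mapP[i _ ->].
Qed.

End compact_operator_norm.

(** * The top singular space and its orthogonal projection *)

Section top_singular_space.
Context {R : realType} {H : hilbertType R}.
Implicit Types (x y : compop H) (v w : H) (s : seq H).

Definition top_space x : set H := [set v | rnorm (x v) = opnorm x * rnorm v].

(* [v] is a null vector of the positive semidefinite form
   [opnorm x ^+ 2 * rip v w - rip (x v) (x w)]. *)
Lemma top_space_rip x v : top_space x v ->
  forall w, rip (x v) (x w) = opnorm x ^+ 2 * rip v w.
Proof.
move=> Ev w; set l := opnorm x.
pose B := l ^+ 2 * rip v w - rip (x v) (x w).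
pose C := l ^+ 2 * rnorm w ^+ 2 - rnorm (x w) ^+ 2.
have l0 : 0 <= l := opnorm_ge0 x.
have sq u : rnorm (x u) ^+ 2 <= l ^+ 2 * rnorm u ^+ 2.
  by rewrite -exprMn ler_sqr ?nnegrE ?mulr_ge0 ?rnorm_ge0// rnorm_compop_le.
have C0 : 0 <= C by rewrite subr_ge0.
have q t : 0 <= 2 * t * B + t ^+ 2 * C.
  have := sq (v + t%:C *: w).
  rewrite compopD compopZ !rnormD2 !rnormZr !ripZr !exprMn !real_normK ?num_real//.
  rewrite Ev -/l exprMn /B /C; lra.
(* The inequality [q] is used at [t = - B / (C + 1)], near the minimum of the quadratic; the
   denominator [C + 1] is positive even if [C = 0]. *)
suff : B = 0 by rewrite /B; lra.
clearbody B C; have C1 : 0 < C + 1 by lra.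
have : 0 <= - (B ^+ 2) * (C + 2).
  have -> : - (B ^+ 2) * (C + 2) = (2 * (- B / (C + 1)) * B +
      (- B / (C + 1)) ^+ 2 * C) * (C + 1) ^+ 2 by field; lra.
  by rewrite mulr_ge0 ?q ?sqr_ge0.
by move=> h; apply/eqP; rewrite -sqrf_eq0; apply/eqP; nra.
Qed.

(** With [top_space_rip], this replaces the norm equation by conditions linear in [v], from which
    closure under sums is immediate. *)
Lemma rip_top_space x v :
  (forall w, rip (x v) (x w) = opnorm x ^+ 2 * rip v w) -> top_space x v.
Proof.
move=> /(_ v); rewrite !ripxx -exprMn => /eqP.
by rewrite eqrXn2 ?mulr_ge0 ?rnorm_ge0 ?opnorm_ge0// => /eqP.
Qed.

Lemma top_spaceD x v w : top_space x v -> top_space x w -> top_space x (v + w).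
Proof.
move=> /top_space_rip v1 /top_space_rip w1; apply: rip_top_space => u.
by rewrite compopD !ripDl v1 w1 mulrDr.
Qed.

Lemma top_spaceZ x (a : R[i]) v : top_space x v -> top_space x (a *: v).
Proof. by move=> v1; rewrite /top_space/= compopZ !rnormZ v1 mulrCA. Qed.

Lemma top_space_sum x s (c : H -> R[i]) :
  (forall e, e \in s -> top_space x e) -> top_space x (\sum_(e <- s) c e *: e).
Proof.
elim: s => [_|e s IH h].
  by rewrite big_nil /top_space /= compop0 rnorm0 mulr0.
rewrite big_cons; apply: top_spaceD.
  by apply/top_spaceZ/h; rewrite mem_head.
by apply: IH => f fs; apply: h; rewrite inE fs orbT.
Qed.

Definition expand s v := \sum_(e <- s) inner v e *: e.

Definition orthonormal_in x s := [/\ uniq s,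
  {in s &, forall e f, inner e f = (e == f)%:R} &
  forall e, e \in s -> top_space x e].

(** Differences of orthonormal vectors have squared norm 2 and stay in the top space, so their
    images are at least [opnorm x] apart and [compact_separated] applies. *)
Lemma size_orthonormal_in x : 0 < opnorm x ->
  exists n : nat, forall s, orthonormal_in x s -> (size s <= n)%N.
Proof.
move=> l0; have [n hn] := compact_separated x l0; exists n => s [us os Es].
have n1 i : (i < size s)%N -> rnorm s`_i = 1.
  move=> /(mem_nth 0) si; have := os _ _ si si; rewrite eqxx inner_norm -rnormE.
  rewrite -rmorphXn => /(@complexI R _ 1)/eqP.
  by rewrite sqrf_eq1 => /orP[/eqP//|/eqP h]; have := rnorm_ge0 s`_i; lra.
apply: (hn _ (fun i => s`_i)) => [i /n1->//|i j /andP[ij js]].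
have is_ := ltn_trans ij js.
rewrite -compopB.
rewrite -ler_sqr ?nnegrE ?rnorm_ge0 ?opnorm_ge0//.
have -> : rnorm (x (s`_i - s`_j)) = opnorm x * rnorm (s`_i - s`_j).
  apply: top_spaceD; first exact/Es/mem_nth.
  by rewrite -scaleN1r; apply: top_spaceZ; exact/Es/mem_nth.
rewrite exprMn rnormB2 !n1// /rip os ?mem_nth// nth_uniq// (ltn_eqF ij) /=.
rewrite ler_peMr ?sqr_ge0//; lra.
Qed.

Lemma expand_orthonormal s f v : uniq s ->
  {in s &, forall e f, inner e f = (e == f)%:R} -> f \in s ->
  inner (expand s v) f = inner v f.
Proof.
move=> us os fs; rewrite /expand linear_sumlz (bigD1_seq f)//=.
rewrite linearZl_LR /= (os f f)// eqxx mulr1 big_seq_cond big1 ?addr0// => e /andP[es ef].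
by rewrite linearZl_LR /= (os e f)// (negbTE ef) mulr0.
Qed.

(* The empty list is imposed for [x = 0] because [top_space 0] is the whole
   space; this makes the projection below vanish. *)
Lemma orthonormal_basis x : exists s, [/\
  forall e, e \in s -> top_space x e,
  0 < opnorm x -> forall v, top_space x v -> expand s v = v &
  opnorm x = 0 -> s = [::]].
Proof.
have [l0|l0] := ltrP 0 (opnorm x); last by exists [::].
have [n hn] := size_orthonormal_in l0.
pose good m := `[< exists2 s, size s = m & orthonormal_in x s >].
have g0 : exists m, good m by exists 0%N; apply/asboolP; exists [::].
have gn m : good m -> (m <= n)%N by move=> /asboolP[s <-]; exact: hn.
case: (ex_maxnP g0 gn) => m /asboolP[s <- [us os Es]] smax.
exists s; split=> [//|_ v Ev|x0]; last by move: l0; rewrite x0 ltxx.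
apply/eqP; rewrite -subr_eq0; apply/negPn/negP.
set r := expand s v - v => r0.
(* The defect [r] lies in the top space and is orthogonal to [s]; normalized, it would extend the
   family [s] of maximal size. *)
have Er : top_space x r.
  apply: top_spaceD; first exact: top_space_sum.
  by rewrite -scaleN1r; exact: top_spaceZ.
have rf f : f \in s -> inner r f = 0.
  by move=> fs; rewrite linearBl /= expand_orthonormal// subrr.
pose e := (rnorm r)^-1%:C *: r.
have ee : inner e e = 1.
  by rewrite inner_norm -rnormE rnorm_normalize// expr1n.
have ef f : f \in s -> inner e f = 0.
  by move=> fs; rewrite linearZl_LR /= rf// mulr0.
have es : e \notin s by apply/negP => /ef/eqP; rewrite ee oner_eq0.
suff : good (size s).+1 by move=> /smax; rewrite ltnn.
apply/asboolP; exists (e :: s) => //; split.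
- by rewrite /= es.
- move=> f g; rewrite !inE => /orP[/eqP->|fs] /orP[/eqP->|gs].
  + by rewrite eqxx ee.
  + by rewrite ef//; case: eqP => // eg; move: es; rewrite eg gs.
  + rewrite (hermC _ f e) expr0 mul1r /= ef// conjC0.
    by case: eqP => // fe; move: es; rewrite -fe fs.
  + exact: os.
- by move=> f; rewrite inE => /orP[/eqP->|/Es//]; exact: top_spaceZ.
Qed.

Definition top_basis x : seq H := projT1 (cid (orthonormal_basis x)).

Definition top_proj x : H -> H := expand (top_basis x).

Lemma top_basis_sub x e : e \in top_basis x -> top_space x e.
Proof. by rewrite /top_basis; case: cid => s /= [h _ _]; exact: h. Qed.

Lemma top_projP x v : top_space x (top_proj x v).
Proof. by apply: top_space_sum => e; exact: top_basis_sub. Qed.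

Lemma top_proj_id x v : 0 < opnorm x -> top_space x v -> top_proj x v = v.
Proof.
rewrite /top_proj /top_basis; case: cid => s /= [_ h _] /h; exact.
Qed.

Lemma top_proj0 x v : opnorm x = 0 -> top_proj x v = 0.
Proof.
rewrite /top_proj /top_basis; case: cid => s /= [_ _ h] /h ->.
by rewrite /expand big_nil.
Qed.

Lemma top_projK x v : top_proj x (top_proj x v) = top_proj x v.
Proof.
have := opnorm_ge0 x; rewrite le_eqVlt => /orP[/eqP/esym x0|x0].
  by rewrite !top_proj0.
by rewrite top_proj_id//; exact: top_projP.
Qed.

Lemma expandD s v w : expand s (v + w) = expand s v + expand s w.
Proof.
rewrite -big_split; apply: eq_bigr => e _.
by rewrite linearDl scalerDl.
Qed.

Lemma expandZ s (a : R[i]) v : expand s (a *: v) = a *: expand s v.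
Proof.
rewrite scaler_sumr; apply: eq_bigr => e _.
by rewrite linearZl_LR scalerA.
Qed.

Lemma top_projD x v w : top_proj x (v + w) = top_proj x v + top_proj x w.
Proof. exact: expandD. Qed.

Lemma top_projZ x (a : R[i]) v : top_proj x (a *: v) = a *: top_proj x v.
Proof. exact: expandZ. Qed.

Lemma top_projB x v w : top_proj x (v - w) = top_proj x v - top_proj x w.
Proof. by rewrite top_projD -scaleN1r top_projZ scaleN1r. Qed.

(** The adjoint of a sum of rank-one operators exchanges [f] and [g]. This yields both the
    self-adjointness of the projection and the adjoint of the partial isometry. *)
Lemma inner_expand s (f g : H -> H) v w :
  inner (\sum_(e <- s) inner v (f e) *: g e) w =
  inner v (\sum_(e <- s) inner w (g e) *: f e).
Proof.
rewrite linear_sumlz linear_sumr; apply: eq_bigr => e _.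
rewrite linearZl_LR linearZr_LR (hermC _ w (g e)) expr0 mul1r /=.
by rewrite conjCK mulrC.
Qed.

Lemma rip_top_proj x v w : rip (top_proj x v) w = rip v (top_proj x w).
Proof. by rewrite /rip (inner_expand _ id id). Qed.

Lemma rip_top_proj_orth x v w : rip (top_proj x v) (w - top_proj x w) = 0.
Proof. by rewrite rip_top_proj top_projB top_projK subrr rip0r. Qed.

Lemma rnorm_top_proj x v : rnorm (x (top_proj x v)) = opnorm x * rnorm (top_proj x v).
Proof. exact: top_projP. Qed.

Lemma top_proj_pythagoras x v :
  rnorm v ^+ 2 = rnorm (top_proj x v) ^+ 2 + rnorm (v - top_proj x v) ^+ 2.
Proof.
have {1}-> : v = top_proj x v + (v - top_proj x v) by rewrite addrC subrK.
by rewrite rnormD2 rip_top_proj_orth mulr0 addr0.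
Qed.

Lemma rnorm_top_proj_le x v : rnorm (top_proj x v) <= rnorm v.
Proof.
rewrite -ler_sqr ?nnegrE ?rnorm_ge0// (top_proj_pythagoras x v).
by rewrite lerDl sqr_ge0.
Qed.

Lemma rnorm_top_projC_le x v : rnorm (v - top_proj x v) <= rnorm v.
Proof.
rewrite -ler_sqr ?nnegrE ?rnorm_ge0// (top_proj_pythagoras x v).
by rewrite lerDr sqr_ge0.
Qed.

(** For [x <> 0], pairing [x (top_proj x v)] with [x v = 0] gives [opnorm x ^+ 2] times the squared
    norm of [top_proj x v]. *)
Lemma top_proj_ker x v : x v = 0 -> top_proj x v = 0.
Proof.
move=> xv; have := opnorm_ge0 x; rewrite le_eqVlt => /orP[/eqP/esym x0|x0].
  by rewrite top_proj0.
have := top_space_rip (top_projP x v) v.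
rewrite xv rip0r -top_projK rip_top_proj top_projK ripxx => /esym/eqP.
by rewrite mulf_eq0 !sqrf_eq0 (gt_eqF x0) rnorm_eq0 => /eqP.
Qed.

End top_singular_space.

(** * Deflation and the singular value decomposition *)

Lemma rip_inj (R : realType) (H : hilbertType R) (v w : H) :
  (forall z, rip v z = rip w z) -> v = w.
Proof.
move=> h; apply/eqP; rewrite -subr_eq0 -rnorm_eq0 -sqrf_eq0 -ripxx.
by rewrite ripDl ripNl h subrr.
Qed.

Section deflation.
Context {R : realType} {H : hilbertType R}.
Implicit Types (x y : compop H) (v w z : H).

Lemma compop_comp_contraction x (L : H -> H) :
  linear L -> (forall v, rnorm (L v) <= rnorm v) -> x \o L \in compop_pred H.
Proof.
move=> linL cL; apply/asboolP; split=> [a v w /=|].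
  by rewrite linL compopD compopZ.
apply: (@subclosed_compact _ _ (closure (x @` unit_ball))).
- exact: closed_closure.
- exact: compop_compact.
apply: closure_subset => _ [v /unit_ballP v1 <-].
by exists (L v) => //; apply/unit_ballP/(le_trans (cL v)).
Qed.

Lemma top_part_subproof x : x \o top_proj x \in compop_pred H.
Proof.
apply: compop_comp_contraction => [a v w|v]; last exact: rnorm_top_proj_le.
by rewrite top_projD top_projZ.
Qed.

Definition top_part x : compop H := Compop (top_part_subproof x).

Definition top_isometry x : compop H := (opnorm x)^-1%:C *: top_part x.

Lemma top_isometryE x v :
  top_isometry x v = (opnorm x)^-1%:C *: x (top_proj x v).
Proof. by []. Qed.

Definition deflate x : compop H := x - top_part x.

Lemma deflateE x v : deflate x v = x (v - top_proj x v).
Proof. by rewrite compopB. Qed.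

Lemma scale_top_isometry x : (opnorm x)%:C *: top_isometry x = top_part x.
Proof.
apply/val_inj/funext => v /=.
rewrite -[LHS]/((opnorm x)%:C *: top_isometry x v) top_isometryE scalerA.
rewrite -rmorphM; have [x0|x0] := eqVneq (opnorm x) 0.
  by rewrite top_proj0// compop0 scaler0.
by rewrite mulfV// scale1r.
Qed.

(** If [deflate x], which attains its norm at some [v], reached [opnorm x], then
    [z = v - top_proj x v] would be a unit vector of the top space that [top_proj x] kills. *)
Lemma opnorm_deflate_lt x : 0 < opnorm x -> opnorm (deflate x) < opnorm x.
Proof.
move=> x0; have := opnorm_ge0 (deflate x); rewrite le_eqVlt => /orP[/eqP<-//|d0].
have [v v1 <-] := opnorm_attained d0; rewrite ltNge; apply/negP.
rewrite deflateE; set z := v - top_proj x v => h.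
have z1 : rnorm z <= 1 by rewrite -v1 rnorm_top_projC_le.
have xz := rnorm_compop_le x z.
have z1' : rnorm z = 1.
  by apply/eqP; rewrite eq_le z1 -(ler_pM2l x0) mulr1 (le_trans h).
have /(top_proj_id x0) : top_space x z.
  by apply/eqP; rewrite eq_le xz z1' mulr1.
rewrite {1}/z top_projB top_projK subrr => z0.
by move: z1'; rewrite -z0 rnorm0 => /eqP; rewrite eq_sym oner_eq0.
Qed.

Lemma opnorm_deflate_le x : opnorm (deflate x) <= opnorm x.
Proof.
apply: opnorm_le_bound (opnorm_ge0 x) _ => v; rewrite deflateE.
rewrite (le_trans (rnorm_compop_le _ _))// ler_wpM2l ?opnorm_ge0//.
exact: rnorm_top_projC_le.
Qed.

Definition remainder n x : compop H := iter n deflate x.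

Definition sing_val n x : R := opnorm (remainder n x).

Definition sing_proj n x : H -> H := top_proj (remainder n x).

Lemma sing_projK n x v : sing_proj n x (sing_proj n x v) = sing_proj n x v.
Proof. exact: top_projK. Qed.

Lemma sing_projB n x v w :
  sing_proj n x (v - w) = sing_proj n x v - sing_proj n x w.
Proof. exact: top_projB. Qed.

Lemma rip_sing_proj n x v w :
  rip (sing_proj n x v) w = rip v (sing_proj n x w).
Proof. exact: rip_top_proj. Qed.

(** The orthogonal projection onto the complement of the first [n] singular spaces; [remainder n x]
    is [x] composed with it. *)
Fixpoint residual n x v : H :=
  if n is m.+1 then residual m x v - sing_proj m x v else v.

Lemma residualB n x v w : residual n x (v - w) = residual n x v - residual n x w.
Proof.
elim: n => //= n ->; rewrite sing_projB !opprD !opprK.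
by rewrite addrACA.
Qed.

(** The inductive step for the first three properties uses the last two at level [n]. Those follow
    from the first three: [v - residual n x v] is in the kernel of [remainder n x], so
    [top_proj_ker] applies, and self-adjointness gives the other order. *)
Lemma residual_props n x :
  [/\ forall v, remainder n x v = x (residual n x v),
      forall v, residual n x (residual n x v) = residual n x v,
      forall v w, rip (residual n x v) w = rip v (residual n x w),
      forall v, sing_proj n x (residual n x v) = sing_proj n x v &
      forall v, residual n x (sing_proj n x v) = sing_proj n x v].
Proof.
have ext m : (forall v, remainder m x v = x (residual m x v)) ->
    (forall v, residual m x (residual m x v) = residual m x v) ->
    (forall v w, rip (residual m x v) w = rip v (residual m x w)) ->
    (forall v, sing_proj m x (residual m x v) = sing_proj m x v) /\
    (forall v, residual m x (sing_proj m x v) = sing_proj m x v).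
  move=> h1 h2 h3; have h4 v : sing_proj m x (residual m x v) = sing_proj m x v.
    apply/eqP; rewrite -subr_eq0 -sing_projB; apply/eqP/top_proj_ker.
    by rewrite h1 residualB h2 subrr compop0.
  by split=> // v; apply: rip_inj => w; rewrite h3 !rip_sing_proj h4.
suff [h1 h2 h3] : [/\ forall v, remainder n x v = x (residual n x v),
      forall v, residual n x (residual n x v) = residual n x v &
      forall v w, rip (residual n x v) w = rip v (residual n x w)].
  by have [] := ext n h1 h2 h3.
elim: n => [//|n [h1 h2 h3]]; have [h4 h5] := ext n h1 h2 h3; split=> [v|v|v w].
- by rewrite -[LHS]/(deflate (remainder n x) v) deflateE h1 /= residualB h5.
- by rewrite /= residualB h2 h5 sing_projB h4 sing_projK subrr subr0.
- by rewrite /= ripDl ripDr ripNl ripNr h3 rip_sing_proj.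
Qed.

Lemma remainderE n x v : remainder n x v = x (residual n x v).
Proof. by have [] := residual_props n x. Qed.

Lemma residualK n x v : residual n x (residual n x v) = residual n x v.
Proof. by have [] := residual_props n x. Qed.

Lemma rip_residual n x v w : rip (residual n x v) w = rip v (residual n x w).
Proof. by have [] := residual_props n x. Qed.

Lemma residual_sing_proj n x v : residual n x (sing_proj n x v) = sing_proj n x v.
Proof. by have [] := residual_props n x. Qed.

Lemma sing_proj_residual n x v : sing_proj n x (residual n x v) = sing_proj n x v.
Proof. by have [] := residual_props n x. Qed.

Lemma remainder_sing_proj n x v :
  remainder n x (sing_proj n x v) = x (sing_proj n x v).
Proof. by rewrite remainderE residual_sing_proj. Qed.

Lemma residualS n x v : residual n.+1 x v = residual n x v - sing_proj n x v.
Proof. by []. Qed.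

Lemma residualS_sing_proj n x v : residual n.+1 x (sing_proj n x v) = 0.
Proof. by rewrite residualS residual_sing_proj sing_projK subrr. Qed.

Lemma residual_le m n x v : (m <= n)%N ->
  residual m x (residual n x v) = residual n x v.
Proof.
elim: n v => [|n IH] v.
  by rewrite leqn0 => /eqP->.
rewrite leq_eqVlt => /orP[/eqP->|]; first exact: residualK.
rewrite ltnS => mn; rewrite residualS residualB IH//; congr (_ - _).
by rewrite -residual_sing_proj IH.
Qed.

Lemma residual_sing_proj_lt m n x v : (m < n)%N ->
  residual m.+1 x (sing_proj n x v) = sing_proj n x v.
Proof. by move=> mn; rewrite -residual_sing_proj residual_le. Qed.

Lemma rip_sub_residual n x v w : rip (v - residual n x v) (residual n x w) = 0.
Proof. by rewrite -rip_residual residualB residualK subrr rip0l. Qed.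

(** The singular spaces reduce [x^* x], so [x] keeps their span and its complement orthogonal. The
    space added at each step is a top space of [remainder n x], where [top_space_rip] reduces the
    claim to orthogonality of the arguments. *)
Lemma rip_compop_residual n x v w :
  rip (x (v - residual n x v)) (x (residual n x w)) = 0.
Proof.
elim: n v w => [|n IH] v w; first by rewrite /= subrr compop0 rip0l.
have -> : v - residual n.+1 x v = (v - residual n x v) + sing_proj n x v.
  by rewrite residualS opprB addrA addrAC.
have E : residual n.+1 x w = residual n x (residual n.+1 x w).
  by rewrite residual_le.
rewrite compopD ripDl E IH add0r -E -remainder_sing_proj E -remainderE.
rewrite (top_space_rip (top_projP _ _)) rip_sing_proj.
by rewrite residualS sing_projB sing_proj_residual sing_projK subrr rip0r mulr0.
Qed.

Lemma rnorm_sing_proj n x v :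
  rnorm (x (sing_proj n x v)) = sing_val n x * rnorm (sing_proj n x v).
Proof. by rewrite -remainder_sing_proj rnorm_top_proj. Qed.

(** [v - residual n.+1 x v] is the component of [v] in the singular spaces 0 to [n]. By Pythagoras
    before and after [x], each piece is stretched by a factor of at least [sing_val n x]. *)
Lemma rnorm_sub_residual_ge n x v :
  (sing_val n x * rnorm (v - residual n.+1 x v)) ^+ 2 <=
  rnorm (x (v - residual n.+1 x v)) ^+ 2.
Proof.
elim: n => [|n IH].
  by rewrite /= opprB addrC subrK rnorm_sing_proj.
have -> : v - residual n.+2 x v = (v - residual n.+1 x v) + sing_proj n.+1 x v.
  by rewrite (residualS n.+1) opprB addrA addrAC.
rewrite compopD exprMn (rnormD2 (v - _)) (rnormD2 (x (v - _))).
rewrite -{1}(residual_sing_proj n.+1) rip_sub_residual.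
rewrite -{2}(residual_sing_proj n.+1 x v) rip_compop_residual.
rewrite rnorm_sing_proj exprMn !mulr0 !addr0 mulrDr lerD2r.
apply: le_trans IH; rewrite exprMn ler_wpM2r ?sqr_ge0//.
rewrite ler_sqr ?nnegrE ?opnorm_ge0//; exact: opnorm_deflate_le.
Qed.

Lemma rnorm_residual_le n x v :
  rnorm (x (residual n x v)) <= sing_val n x * rnorm (residual n x v).
Proof. by rewrite -residualK -remainderE residualK rnorm_compop_le. Qed.

Lemma sing_projM j k x v : j <> k -> sing_proj j x (sing_proj k x v) = 0.
Proof.
have lt m n v' w : (m < n)%N -> rip (sing_proj m x v') (sing_proj n x w) = 0.
  move=> mn; rewrite -(residual_sing_proj_lt x w mn) -rip_residual.
  by rewrite residualS_sing_proj rip0l.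
move=> jk; apply: rip_inj => w; rewrite rip_sing_proj rip0l.
case: (ltngtP j k) => // [jk'|kj]; last exact: lt.
by rewrite ripC lt.
Qed.

Lemma rip_compop_sing_proj j k x v w : j <> k ->
  rip (x (sing_proj j x v)) (x (sing_proj k x w)) = 0.
Proof.
have lt m n v' w' : (m < n)%N ->
    rip (x (sing_proj m x v')) (x (sing_proj n x w')) = 0.
  move=> mn; rewrite -(residual_sing_proj_lt x w' mn).
  rewrite -(subr0 (sing_proj m x v')) -(residualS_sing_proj m x v').
  exact: rip_compop_residual.
by move=> jk; case: (ltngtP j k) => // [jk'|kj]; [exact: lt|rewrite ripC lt].
Qed.

Lemma sing_vec n x : 0 < sing_val n x ->
  exists2 v, rnorm v = 1 & sing_proj n x v = v.
Proof.
move=> l0; have [v v1 xv] := opnorm_attained l0; exists v => //.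
by apply: top_proj_id => //; rewrite /top_space /= v1 mulr1.
Qed.

Lemma sing_val_ge0 n x : 0 <= sing_val n x.
Proof. exact: opnorm_ge0. Qed.

Lemma sing_val_lt n x : 0 < sing_val n x -> sing_val n.+1 x < sing_val n x.
Proof. exact: opnorm_deflate_lt. Qed.

Lemma sing_val_le m n x : (m <= n)%N -> sing_val n x <= sing_val m x.
Proof.
elim: n => [|n IH]; first by rewrite leqn0 => /eqP->.
rewrite leq_eqVlt => /orP[/eqP->//|/IH]; apply: le_trans.
exact: opnorm_deflate_le.
Qed.

(** Otherwise unit vectors from all the singular spaces would have orthogonal images of norm at
    least [e], against [compact_separated]. *)
Lemma sing_val_lim x (e : R) : 0 < e -> exists n, sing_val n x < e.
Proof.
move=> e0; apply: contrapT => h.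
have he n : e <= sing_val n x by rewrite leNgt; apply/negP => ?; apply: h; exists n.
have ex n : {v | rnorm v = 1 & sing_proj n x v = v}.
  by apply/cid2/sing_vec/(lt_le_trans e0).
pose f n := s2val (ex n).
have f1 n : rnorm (f n) = 1 by rewrite /f; case: (ex n).
have fP n : sing_proj n x (f n) = f n by rewrite /f; case: (ex n).
have [n hn] := compact_separated x e0.
suff : (n.+1 <= n)%N by rewrite ltnn.
apply: (hn _ f) => [i _|i j /andP[ij _]]; first by rewrite f1.
rewrite -ler_sqr ?nnegrE ?rnorm_ge0 ?(ltW e0)// rnormB2 -(fP i) -(fP j).
rewrite rip_compop_sing_proj; last by move=> eij; rewrite eij ltnn in ij.
rewrite mulr0 subr0 !rnorm_sing_proj !fP !f1 !mulr1.
have : e ^+ 2 <= sing_val i x ^+ 2 by rewrite ler_sqr ?nnegrE ?sing_val_ge0 ?(ltW e0).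
have := sqr_ge0 (sing_val j x); lra.
Qed.

Definition sing_isometry n x : compop H := top_isometry (remainder n x).

Lemma sing_isometryE n x v :
  sing_isometry n x v = (sing_val n x)^-1%:C *: x (sing_proj n x v).
Proof. by rewrite /sing_isometry top_isometryE remainder_sing_proj. Qed.

Lemma sing_isometry0 n x : sing_val n x = 0 -> sing_isometry n x = 0.
Proof.
move=> l0; apply/val_inj/funext => v /=; rewrite -[LHS]/(sing_isometry n x v).
by rewrite sing_isometryE l0 invr0 scale0r.
Qed.

(** The sum telescopes: each term is the top part that deflation removes. *)
Lemma series_sing n x :
  series (fun k => (sing_val k x)%:C *: sing_isometry k x) n = x - remainder n x.
Proof.
rewrite /series /=; elim: n => [|n IH]; first by rewrite big_nil subrr.
rewrite big_nat_recr//= IH scale_top_isometry.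
by rewrite /deflate opprB addrA addrAC.
Qed.

Lemma series_sing_cvg x :
  series (fun k => (sing_val k x)%:C *: sing_isometry k x) @ \oo --> x.
Proof.
apply: cvg_rnormP => e e0; have [N hN] := sing_val_lim x e0.
exists N => // n /= Nn; rewrite series_sing opprB addrC subrK.
exact: le_lt_trans (sing_val_le x Nn) hN.
Qed.

Lemma top_isometry_expand x v : top_isometry x v =
  \sum_(e <- top_basis x) inner v e *: ((opnorm x)^-1%:C *: x e).
Proof.
rewrite top_isometryE compop_sum scaler_sumr; apply: eq_bigr => e _.
by rewrite !scalerA mulrC.
Qed.

Lemma finite_rank_top_isometry x : finite_rank (top_isometry x).
Proof.
pose f e := (opnorm x)^-1%:C *: x e.
exists (map f (top_basis x)) => v; exists (fun i => inner v (top_basis x)`_i).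
rewrite top_isometry_expand.
rewrite -(big_mkord xpredT
  (fun i => inner v (top_basis x)`_i *: (map f (top_basis x))`_i)).
rewrite size_map (big_nth 0) [LHS]big_nat_cond [RHS]big_nat_cond.
apply: eq_bigr => i /andP[/andP[_ il] _].
by rewrite (nth_map 0).
Qed.

(** The adjoint is exhibited as an explicit finite sum, which [adjointE] identifies without the
    Riesz theorem. *)
Lemma rip_adjoint_top_isometry x v w :
  rip (top_isometry x v) w = rip v (adjoint (top_isometry x) w).
Proof.
rewrite (@adjointE _ _ (top_isometry x) (fun w =>
  \sum_(e <- top_basis x) inner w ((opnorm x)^-1%:C *: x e) *: e)).
  by rewrite top_isometry_expand /rip (inner_expand _ id).
by move=> a b; rewrite top_isometry_expand (inner_expand _ id).
Qed.

Lemma partial_isometry_top_isometry x : partial_isometry (top_isometry x).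
Proof.
move=> v vker; have [x0|x0] := eqVneq (opnorm x) 0.
  have -> : v = 0; last by rewrite compop0.
  apply/eqP; rewrite -rnorm_eq0 -sqrf_eq0 -ripxx /rip vker//.
  by rewrite top_isometryE x0 invr0 scale0r.
(* The vector [v - top_proj x v] is in the kernel of the isometry, hence orthogonal to [v]; its
   squared norm is therefore 0. *)
have Pv : top_proj x v = v.
  apply/eqP; rewrite eq_sym -subr_eq0 -rnorm_eq0 -sqrf_eq0 -ripxx {1}ripDl.
  rewrite ripNl rip_top_proj_orth subr0 /rip vker//.
  by rewrite top_isometryE top_projB top_projK subrr compop0 scaler0.
rewrite -!rnormE top_isometryE rnormZr rnorm_top_proj Pv.
by rewrite ger0_norm ?invr_ge0 ?opnorm_ge0// mulKf.
Qed.

(** The final spaces are orthogonal by [rip_compop_sing_proj]. The adjoint of the [k]-th isometry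
    takes values in the [k]-th singular space, which [sing_proj j x] kills. *)
Lemma orthogonal_sing_isometry x j k : j <> k ->
  orthogonal_operators (sing_isometry j x) (sing_isometry k x).
Proof.
move=> jk; split; apply/funext => v; rewrite -[RHS]/(0 : H).
  rewrite -[LHS]/(adjoint (sing_isometry j x) (sing_isometry k x v)).
  apply: rip_inj => w; rewrite rip0l ripC -rip_adjoint_top_isometry.
  rewrite -/(sing_isometry j x) !sing_isometryE ripZl ripZr.
  by rewrite rip_compop_sing_proj// !mulr0.
rewrite -[LHS]/(sing_isometry j x (adjoint (sing_isometry k x) v)).
have -> : adjoint (sing_isometry k x) v =
    sing_proj k x (adjoint (sing_isometry k x) v).
  apply: rip_inj => w; rewrite rip_sing_proj !(ripC (adjoint _ _)).
  rewrite -!rip_adjoint_top_isometry -/(sing_isometry k x) !sing_isometryE.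
  by rewrite sing_projK.
by rewrite sing_isometryE sing_projM// compop0 scaler0.
Qed.

End deflation.

(** * Perturbation of singular values and top projections *)

Section perturbation.
Context {R : realType} {H : hilbertType R}.
Implicit Types (x y : compop H) (v w z : H).

Lemma rip_compop_perturb x y v w :
  `|rip (y v) (y w) - rip (x v) (x w)| <=
  (opnorm x + opnorm y) * opnorm (x - y) * (rnorm v * rnorm w).
Proof.
have -> : rip (y v) (y w) - rip (x v) (x w) =
    - (rip (x v) ((x - y) w) + rip ((x - y) v) (y w)).
  rewrite -[(x - y) w]/(x w - y w) -[(x - y) v]/(x v - y v).
  by rewrite !(ripDl, ripDr, ripNl, ripNr); ring.
rewrite normrN (le_trans (ler_normD _ _))//.
have h1 := rip_norm_le (x v) ((x - y) w).
have h2 := rip_norm_le ((x - y) v) (y w).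
have h3 : rnorm (x v) * rnorm ((x - y) w) <=
    (opnorm x * rnorm v) * (opnorm (x - y) * rnorm w).
  by apply: ler_pM; rewrite ?rnorm_ge0 ?rnorm_compop_le.
have h4 : rnorm ((x - y) v) * rnorm (y w) <=
    (opnorm (x - y) * rnorm v) * (opnorm y * rnorm w).
  by apply: ler_pM; rewrite ?rnorm_ge0 ?rnorm_compop_le.
lra.
Qed.

(** This says that [y^* y - x^* x] has norm at most [e], in weak form and so without adjoints. *)
Definition form_close (e : R) x y := forall v w,
  `|rip (y v) (y w) - rip (x v) (x w)| <= e * (rnorm v * rnorm w).

Lemma form_closeC e x y : form_close e x y -> form_close e y x.
Proof. by move=> h v w; rewrite distrC. Qed.

Lemma near_form_close x (e : R) : 0 < e -> \forall y \near x, form_close e x y.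
Proof.
move=> e0; have x0 := opnorm_ge0 x.
have M0 : 0 < 2 * opnorm x + 1 by lra.
pose d := Num.min 1 (e / (2 * opnorm x + 1)).
have d0 : 0 < d by rewrite lt_min ltr01 divr_gt0.
apply: filterS (near_rnorm x d0) => y; rewrite rnorm_compop lt_min => /andP[y1 ye].
move=> v w; apply: le_trans (rip_compop_perturb x y v w) _.
apply: ler_wpM2r; first by rewrite mulr_ge0 ?rnorm_ge0.
have : opnorm y <= opnorm x + 1.
  have := rnorm_dist y x; rewrite rdistC !rnorm_compop; lra.
move=> yx; apply: (@le_trans _ _ ((2 * opnorm x + 1) * (e / (2 * opnorm x + 1)))).
  apply: ler_pM; [|exact: opnorm_ge0| |exact: ltW].
    by rewrite addr_ge0 ?opnorm_ge0.
  lra.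
by rewrite mulrCA mulfV ?mulr1// gt_eqF.
Qed.

(** The eigenvector equation of [x^* x] for the [n]-th singular space, tested against every [w] and
    not only against the range of [residual n x]. *)
Lemma rip_sing_vec n x v w : sing_proj n x v = v ->
  rip (x v) (x w) = sing_val n x ^+ 2 * rip v w.
Proof.
move=> vP; have vD : residual n x v = v by rewrite -vP residual_sing_proj.
have -> : x w = x (w - residual n x w) + x (residual n x w).
  by rewrite -compopD subrK.
rewrite -{1}vD ripDr ripC rip_compop_residual add0r -!remainderE.
by rewrite (top_space_rip _)// -vP; exact: top_projP.
Qed.

(* An approximate eigenvector [v] of [y^* y] for the approximate eigenvalue [l]
   is tested against [w], the difference of its components in the sum of the
   first singular spaces of [y] and in the orthogonal complement: if [l] were
   far from all the squared singular values, both components would contribute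
   with the same sign. *)
Lemma sing_val_gap n y v (l e : R) : rnorm v = 1 ->
  (forall w, `|rip (y v) (y w) - l * rip v w| <= e * rnorm w) ->
  l - e <= sing_val n.+1 y ^+ 2 \/ sing_val n y ^+ 2 <= l + e.
Proof.
move=> v1 vl; set r := residual n.+1 y v; set p := v - r.
have vE : v = p + r by rewrite subrK.
have pr : rip p r = 0 by exact: rip_sub_residual.
have ypr : rip (y p) (y r) = 0 by exact: rip_compop_residual.
have p2 := rnorm_sub_residual_ge n y v; rewrite -/r -/p exprMn in p2.
have r2 : rnorm (y r) ^+ 2 <= sing_val n.+1 y ^+ 2 * rnorm r ^+ 2.
  rewrite -exprMn ler_sqr ?nnegrE ?mulr_ge0 ?rnorm_ge0 ?sing_val_ge0//.
  exact: rnorm_residual_le.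
clearbody p r; have s1 : rnorm p ^+ 2 + rnorm r ^+ 2 = 1.
  by rewrite -(expr1n _ 2) -v1 vE rnormD2 pr mulr0 addr0.
have w1 : rnorm (p - r) = 1.
  apply/eqP; rewrite -sqrp_eq1 ?rnorm_ge0//.
  by rewrite rnormB2 pr mulr0 subr0 s1.
have := vl (p - r); rewrite w1 mulr1 => /(le_trans (ler_norm _)).
have -> : rip v (p - r) = rnorm p ^+ 2 - rnorm r ^+ 2.
  by rewrite vE -!ripxx !(ripDl, ripDr, ripNl, ripNr) (ripC r p) pr; ring.
have -> : rip (y v) (y (p - r)) = rnorm (y p) ^+ 2 - rnorm (y r) ^+ 2.
  rewrite vE compopD compopB -!ripxx !(ripDl, ripDr, ripNl, ripNr).
  by rewrite (ripC (y r) (y p)) ypr; ring.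
have [|h1] := lerP (l - e) (sing_val n.+1 y ^+ 2); first by left.
have [|h2] := lerP (sing_val n y ^+ 2) (l + e); first by right.
have p0 := sqr_ge0 (rnorm p); have r0 := sqr_ge0 (rnorm r).
move: (rnorm p ^+ 2) (rnorm r ^+ 2) (rnorm (y p) ^+ 2) (rnorm (y r) ^+ 2)
  (sing_val n y ^+ 2) (sing_val n.+1 y ^+ 2) p2 r2 s1 h1 h2 p0 r0.
move=> P Q P' Q' A B p2 r2 s1 h1 h2 p0 r0 h.
have k1 : 0 <= (A - (l + e)) * P by apply: mulr_ge0 => //; lra.
have k2 : 0 <= (l - e - B) * Q by apply: mulr_ge0 => //; lra.
have k3 : (A - (l + e)) * P + (l - e - B) * Q <= 0 by nra.
have P0 : P = 0.
  have /eqP : (A - (l + e)) * P = 0 by lra.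
  by rewrite mulf_eq0 => /orP[/eqP ?|/eqP//]; lra.
have Q0 : Q = 0.
  have /eqP : (l - e - B) * Q = 0 by lra.
  by rewrite mulf_eq0 => /orP[/eqP ?|/eqP//]; lra.
lra.
Qed.

(** Only lower bounds are claimed: a perturbation may split a multiple singular value, which raises
    the later ones. By induction, a unit singular vector of [x] is fed to [sing_val_gap] for [y],
    and the bound at the previous index rules out the second alternative. *)
Lemma sing_val_form_close n x : 0 < sing_val n x ->
  exists2 d : R, 0 < d & forall (e : R) y, e <= d -> form_close e x y ->
    forall i, (i <= n)%N -> sing_val i x ^+ 2 - e <= sing_val i y ^+ 2.
Proof.
have base y e v : form_close e x y -> rnorm v = 1 -> sing_proj 0 x v = v ->
    sing_val 0 x ^+ 2 - e <= sing_val 0 y ^+ 2.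
  move=> xy v1 /rip_sing_vec vx; have := xy v v; rewrite vx !ripxx v1.
  rewrite !expr1n !mulr1 => /ler_normlP[].
  have : rnorm (y v) ^+ 2 <= sing_val 0 y ^+ 2; last by lra.
  rewrite ler_sqr ?nnegrE ?rnorm_ge0 ?sing_val_ge0//.
  by have := rnorm_compop_le y v; rewrite v1 mulr1.
elim: n => [|n IH] l0; have [v v1 vP] := sing_vec l0.
  exists 1 => // e y _ xy i; rewrite leqn0 => /eqP->; exact: base xy v1 vP.
have ln : 0 < sing_val n x by rewrite (lt_le_trans l0)// sing_val_le.
have [d d0 hd] := IH ln.
pose g := sing_val n x ^+ 2 - sing_val n.+1 x ^+ 2.
have g0 : 0 < g.
  by rewrite subr_gt0 ltr_sqr ?nnegrE ?sing_val_ge0// sing_val_lt.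
(* The second alternative of [sing_val_gap] would force [g <= 2 * e], which [e <= g / 4]
   excludes. *)
exists (Num.min d (g / 4)); first by rewrite lt_min d0 divr_gt0.
move=> e y; rewrite le_min => /andP[ed eg] xy i.
rewrite leq_eqVlt => /orP[/eqP->|]; last exact: hd.
have := hd e y ed xy n (leqnn n) => hn.
have [||//|] := @sing_val_gap n y v (sing_val n.+1 x ^+ 2) e => //.
  by move=> w; have := xy v w; rewrite (rip_sing_vec _ vP) v1 mul1r.
by rewrite /g in eg g0; lra.
Qed.

Lemma sing_val_near n x (a : R) : a < sing_val n x ->
  \forall y \near x, a < sing_val n y.
Proof.
move=> ax; have [a0|a0] := ltrP a 0.
  by near=> y; exact: lt_le_trans a0 (sing_val_ge0 _ _).
have [d d0 hd] := sing_val_form_close (le_lt_trans a0 ax).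
have a2 : a ^+ 2 < sing_val n x ^+ 2 by rewrite ltr_sqr ?nnegrE ?sing_val_ge0.
pose e := Num.min d ((sing_val n x ^+ 2 - a ^+ 2) / 2).
have e0 : 0 < e by rewrite lt_min d0/=; lra.
apply: filterS (near_form_close x e0) => y xy.
rewrite -ltr_sqr ?nnegrE ?sing_val_ge0//.
have ed : e <= d by rewrite ge_min lexx.
have ea : e <= (sing_val n x ^+ 2 - a ^+ 2) / 2 by rewrite ge_min lexx orbT.
have := hd e y ed xy n (leqnn n); lra.
Unshelve. all: by end_near. Qed.

Lemma sing_val_lsc n : lower_semicontinuous (fun x => (sing_val n x)%:E).
Proof.
by move=> x a; rewrite lte_fin => /sing_val_near; exists [set y | a < sing_val n y].
Qed.

Definition gap_ge (d : R) : set (compop H) :=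
  [set x | sing_val 1 x + d <= opnorm x].

Lemma closed_gap_ge d : closed (gap_ge d).
Proof.
rewrite -[gap_ge d]setCK; apply: open_closedC; rewrite openE => x /= /negP.
rewrite -ltNge => h; rewrite /interior /=.
(* The midpoint leaves room both for a drop of [sing_val 1], controlled by semicontinuity, and for a
   change of [opnorm]. *)
pose a := (opnorm x - d + sing_val 1 x) / 2.
have a1 : a < sing_val 1 x by rewrite /a; lra.
have a2 : 0 < a - (opnorm x - d) by rewrite /a; lra.
apply: filterS2 (sing_val_near a1) (near_rnorm x a2) => y y1 xy.
apply/negP; rewrite -ltNge.
have := rnorm_dist y x; rewrite rdistC !rnorm_compop; move: xy; rewrite rnorm_compop; lra.
Qed.

(** The sin-theta estimate. Pairing [v] with [r] gives exactly [opnorm x ^+ 2 * rnorm r ^+ 2] for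
    [x] and at most [sing_val 1 y ^+ 2 * rnorm r ^+ 2] for [y]; one factor [rnorm r] then
    cancels. *)
Lemma top_proj_form_close e x y v : form_close e x y -> top_space x v ->
  (opnorm x ^+ 2 - sing_val 1 y ^+ 2) * rnorm (v - top_proj y v) <= e * rnorm v.
Proof.
move=> xy Ev; set r := v - top_proj y v.
have rE : r = residual 1 y v by [].
have yr : rip (y v) (y r) = rnorm (y r) ^+ 2.
  have -> : y v = y (v - r) + y r by rewrite -compopD subrK.
  by rewrite ripDl ripxx {1 2}rE rip_compop_residual add0r.
have vr : rip v r = rnorm r ^+ 2.
  by rewrite -{1}(subrK r v) ripDl ripxx {1 2}rE rip_sub_residual add0r.
have yr2 : rnorm (y r) ^+ 2 <= sing_val 1 y ^+ 2 * rnorm r ^+ 2.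
  rewrite -exprMn ler_sqr ?nnegrE ?mulr_ge0 ?rnorm_ge0 ?sing_val_ge0//.
  by rewrite rE rnorm_residual_le.
have := xy v r; rewrite yr (top_space_rip Ev) vr => /ler_normlP[h _].
(* The sign of [e] is not given; if [r] vanishes, closeness at the pair [v], [v] makes the
   right-hand side nonnegative. *)
have [r0|r0] := eqVneq (rnorm r) 0.
  rewrite r0 mulr0; move: (xy v v); rewrite -expr2 => /(le_trans (normr_ge0 _)).
  have [v0|v0] := eqVneq (rnorm v) 0; first by rewrite v0 mulr0.
  have v1 : 0 < rnorm v by rewrite lt_neqAle eq_sym v0 rnorm_ge0.
  by rewrite expr2 mulrA pmulr_lge0.
have r1 : 0 < rnorm r by rewrite lt_neqAle eq_sym r0 rnorm_ge0.
rewrite -(ler_pM2r r1); lra.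
Qed.

Lemma top_proj_close d e x y z : 0 < d -> gap_ge d y -> rnorm (x - y) <= d / 2 ->
  form_close e x y ->
  rnorm (top_proj x z - top_proj y (top_proj x z)) <=
    4 * e / d ^+ 2 * rnorm (top_proj x z).
Proof.
move=> d0 Ay xyd xy; have := top_proj_form_close xy (top_projP x z).
have := rnorm_dist y x; rewrite rdistC !rnorm_compop => xy1.
rewrite /gap_ge /= in Ay; rewrite rnorm_compop in xyd.
have l1 := sing_val_ge0 1 y.
(* Half of the gap of [y] survives: [opnorm x] is at least [sing_val 1 y + d / 2]. *)
have g : (d / 2) ^+ 2 <= opnorm x ^+ 2 - sing_val 1 y ^+ 2 by nra.
set a := rnorm (_ - _) => h.
have a0 : 0 <= a := rnorm_ge0 _.
have d2 : 0 < d ^+ 2 by rewrite exprn_gt0.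
have : (d / 2) ^+ 2 * a <= e * rnorm (top_proj x z).
  by apply: le_trans h; exact: ler_wpM2r.
have -> : 4 * e / d ^+ 2 * rnorm (top_proj x z) =
    4 * (e * rnorm (top_proj x z)) / d ^+ 2 by field; rewrite gt_eqF.
rewrite ler_pdivlMr//; lra.
Qed.

(** With projections [P] of [x] and [Q] of [y], [P - Q = (1 - Q) P - Q (1 - P)]. The last product is
    the adjoint of [(1 - P) Q], so [top_proj_close] with [x] and [y] exchanged bounds it. *)
Lemma top_proj_dist d e x y z : 0 < d -> 0 <= e -> gap_ge d x -> gap_ge d y ->
  rnorm (x - y) <= d / 2 -> form_close e x y ->
  rnorm (top_proj x z - top_proj y z) <= 8 * e / d ^+ 2 * rnorm z.
Proof.
move=> d0 e0 Ax Ay xyd xy; set c := 4 * e / d ^+ 2.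
have c0 : 0 <= c by rewrite divr_ge0 ?sqr_ge0// mulr_ge0.
have -> : 8 * e / d ^+ 2 * rnorm z = c * rnorm z + c * rnorm z by rewrite /c; ring.
set t := top_proj y (z - top_proj x z).
have -> : top_proj x z - top_proj y z =
    (top_proj x z - top_proj y (top_proj x z)) - t.
  by rewrite /t top_projB opprB addrA subrK.
apply: le_trans (rnormB _ _) _; apply: lerD.
  apply: le_trans (top_proj_close z d0 Ay xyd xy) _.
  by rewrite ler_wpM2l// rnorm_top_proj_le.
have tt : rnorm t ^+ 2 = rip (t - top_proj x t) z.
  rewrite -ripxx {2}/t -rip_top_proj top_projK -/t.
  by rewrite ripDr ripDl ripNr ripNl rip_top_proj.
have := top_proj_close (z - top_proj x z) d0 Ax _ (form_closeC xy).
rewrite rdistC -/t => /(_ xyd) h.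
have := rip_le (t - top_proj x t) z; rewrite -tt => h'.
have [t0|t0] := eqVneq (rnorm t) 0; first by rewrite t0 mulr_ge0 ?rnorm_ge0.
have t1 : 0 < rnorm t by rewrite lt_neqAle eq_sym t0 rnorm_ge0.
rewrite -(ler_pM2r t1) -expr2 (le_trans h')// mulrAC.
by rewrite ler_wpM2r ?rnorm_ge0.
Qed.

Lemma top_part_cvg d x : 0 < d -> gap_ge d x ->
  top_part @ within (gap_ge d) (nbhs x) --> top_part x.
Proof.
move=> d0 Ax; apply: cvg_rnormP => eps eps0.
have x0 := opnorm_ge0 x.
have d2 : 0 < d ^+ 2 by rewrite exprn_gt0.
(* Chosen so that the bound of [top_proj_dist], multiplied by [opnorm x], is at most [eps / 4]. *)
pose e := eps * d ^+ 2 / (32 * (opnorm x + 1)).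
have e0 : 0 < e by rewrite divr_gt0 ?mulr_gt0//; lra.
have m0 : 0 < Num.min (d / 2) (eps / 2) by rewrite lt_min !divr_gt0.
apply: filterS2 (near_form_close x e0) (near_rnorm x m0) => y xy.
rewrite lt_min => /andP[xyd xye] Ay.
set c := 8 * e / d ^+ 2.
have c0 : 0 <= c by rewrite divr_ge0 ?sqr_ge0// mulr_ge0// ltW.
have xc : opnorm x * c <= eps / 4.
  have -> : c = eps / (4 * (opnorm x + 1)).
    by rewrite /c /e; field; apply/andP; split; [lra|rewrite gt_eqF].
  rewrite mulrA ler_pdivrMr; last lra.
  have := mulr_ge0 (ltW eps0) x0; lra.
suff : rnorm (top_part x - top_part y) <= rnorm (x - y) + opnorm x * c by lra.
rewrite [leLHS]rnorm_compop; apply: opnorm_le_bound.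
  by rewrite addr_ge0 ?rnorm_ge0// mulr_ge0.
move=> z; rewrite -[(top_part x - top_part y) z]/(x (top_proj x z) - y (top_proj y z)).
have -> : x (top_proj x z) - y (top_proj y z) =
    (x - y) (top_proj y z) + x (top_proj x z - top_proj y z).
  rewrite -[(x - y) _]/(x (top_proj y z) - y (top_proj y z)) compopB.
  by rewrite [RHS]addrC addrA subrK.
rewrite mulrDl; apply: le_trans (rnormD _ _) _; apply: lerD.
  apply: le_trans (rnorm_compop_le _ _) _.
  by rewrite rnorm_compop ler_wpM2l ?opnorm_ge0 ?rnorm_top_proj_le.
apply: le_trans (rnorm_compop_le _ _) _; rewrite -mulrA ler_wpM2l//.
by apply: (top_proj_dist _ d0 _ Ax Ay _ xy); exact: ltW.
Qed.

End perturbation.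

(** * Borel measurability from continuity on closed pieces *)

Lemma piecewise_cvg_borel (T T' : ptopologicalType) (f : T -> T')
    (A : nat -> set T) :
  (forall n, closed (A n)) -> \bigcup_n A n = [set: T] ->
  (forall n x, A n x -> f @ within (A n) (nbhs x) --> f x) ->
  measurable_fun [set: borel T] (f : borel T -> borel T').
Proof.
move=> cA AT cf.
apply: (@measurability _ _ (borel T) (borel T') setT f (@open T')) => //.
move=> _ [U oU <-].
rewrite setTI.
have -> : f @^-1` U = \bigcup_n (A n `&` (f @^-1` U)).
  by rewrite -setI_bigcupl AT setTI.
apply: bigcupT_measurable => n.
(* Continuity within [A n] makes the preimage relatively open there: a closed set intersected with
   an open one. *)
have -> : A n `&` (f @^-1` U) =
    ~` (~` A n) `&` interior [set x | A n x -> U (f x)].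
  rewrite setCK; apply/seteqP; split=> x /= [Ax h]; split=> //.
    by apply: (cf n x Ax); exact: open_nbhs_nbhs.
  exact: (nbhs_singleton h).
apply: (@measurableI _ (borel T)).
  apply: (@measurableC _ (borel T)); apply: sub_sigma_algebra.
  exact: closed_openC.
by apply: sub_sigma_algebra; exact: open_interior.
Qed.

Lemma cvg_within_set1 (T T' : topologicalType) (f : T -> T') (x : T) :
  f @ within [set x] (nbhs x) --> f x.
Proof.
move=> U fxU; suff : \forall y \near x, [set x] y -> U (f y) by [].
by near=> y => ->; exact: nbhs_singleton fxU.
Unshelve. all: by end_near. Qed.

Section measurability.
Context {R : realType} {H : hilbertType R}.

(** Piece 0 is reserved for the zero operator, which lies in no [gap_ge d] with [d > 0]. *)
Definition gap_piece (n : nat) : set (compop H) :=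
  if n is m.+1 then gap_ge m.+1%:R^-1 else [set 0].

Lemma closed_gap_piece n : closed (gap_piece n).
Proof.
case: n => [|n]; last exact: closed_gap_ge.
apply: compact_closed; [exact: norm_hausdorff|exact: compact_set1].
Qed.

Lemma bigcup_gap_piece : \bigcup_n gap_piece n = [set: compop H].
Proof.
apply/seteqP; split=> // x _.
have [->|x0] := eqVneq x 0; first by exists 0%N.
have g0 : 0 < opnorm x - sing_val 1 x.
  by rewrite subr_gt0; apply: opnorm_deflate_lt; rewrite opnorm_gt0.
exists (Num.truncn (opnorm x - sing_val 1 x)^-1).+1 => //=; rewrite /gap_ge /=.
rewrite -lerBrDl -[leRHS]invrK lef_pV2 ?posrE ?invr_gt0// ltW//.
exact: truncnS_gt.
Qed.

Lemma top_part_piece_cvg n (x : compop H) : gap_piece n x ->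
  top_part @ within (gap_piece n) (nbhs x) --> top_part x.
Proof.
case: n => [/= ->|n]; last by apply: top_part_cvg; rewrite invr_gt0.
exact: cvg_within_set1.
Qed.

Lemma measurable_deflate : measurable_fun [set: borel (compop H)]
  (@deflate R H : borel (compop H) -> borel (compop H)).
Proof.
apply: (piecewise_cvg_borel closed_gap_piece bigcup_gap_piece) => n x Ax.
apply: cvgB; last exact: top_part_piece_cvg.
exact: cvg_within.
Qed.

Lemma measurable_top_isometry : measurable_fun [set: borel (compop H)]
  (@top_isometry R H : borel (compop H) -> borel (compop H)).
Proof.
apply: (piecewise_cvg_borel closed_gap_piece bigcup_gap_piece) => n x Ax.
(* The inverse of the norm is continuous only away from 0; the zero operator belongs to the
   singleton piece alone, where convergence is trivial. *)
have [x0|x0] := eqVneq x 0.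
  case: n Ax => [_|n]; last first.
    rewrite /= /gap_ge /= x0 opnorm0 => h.
    have := sing_val_ge0 1 (0 : compop H); have : 0 < n.+1%:R^-1 :> R by [].
    by move: h; set t : R := n.+1%:R^-1; lra.
  by rewrite x0; exact: cvg_within_set1.
apply: cvgZ; last exact: top_part_piece_cvg.
have -> : (fun y : compop H => ((opnorm y)^-1)%:C) = (fun y => `|y|^-1).
  by apply/funext => y; rewrite fmorphV.
have -> : ((opnorm x)^-1)%:C = `|x|^-1 by rewrite fmorphV.
apply: cvgV; first by rewrite normr_eq0.
by apply: cvg_norm; exact: cvg_within.
Qed.

Lemma measurable_sing_isometry n : measurable_fun [set: borel (compop H)]
  (@sing_isometry R H n : borel (compop H) -> borel (compop H)).
Proof.
have mr : measurable_fun [set: borel (compop H)]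
    (@remainder R H n : borel (compop H) -> borel (compop H)).
  elim: n => [|n IH]; first exact: measurable_id.
  exact: (measurableT_comp measurable_deflate IH).
exact: (measurableT_comp measurable_top_isometry mr).
Qed.

End measurability.

Theorem theorem4p4 (R : realType) (H : hilbertType R) :
  exists (lambda : nat -> compop H -> R) (u : nat -> compop H -> compop H),
    (forall n : nat,
       (forall x : compop H, 0 <= lambda n x) /\
       lower_semicontinuous (fun x : compop H => (lambda n x)%:E)) /\
    (forall (n : nat) (x : compop H),
       0 < lambda n x -> lambda n.+1 x < lambda n x) /\
    (forall n : nat,
       measurable_fun [set: borel (compop H)]
         (u n : borel (compop H) -> borel (compop H))) /\
    (forall (n : nat) (x : compop H),
       finite_rank (u n x) /\ partial_isometry (u n x)) /\
    (forall (n : nat) (x : compop H), lambda n x = 0 -> u n x = 0) /\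
    (forall (x : compop H) (j k : nat), j <> k ->
       orthogonal_operators (u j x) (u k x)) /\
    (forall x : compop H,
       series (fun n : nat => (lambda n x)%:C *: u n x) @ \oo --> x).
Proof.
exists sing_val, sing_isometry; split.
  by move=> n; split=> [x|]; [exact: sing_val_ge0|exact: sing_val_lsc].
split; first by move=> n x; exact: sing_val_lt.
split; first exact: measurable_sing_isometry.
split.
  move=> n x; split; first exact: finite_rank_top_isometry.
  exact: partial_isometry_top_isometry.
split; first by move=> n x; exact: sing_isometry0.
split; first by move=> x j k; exact: orthogonal_sing_isometry.
exact: series_sing_cvg.
Qed.
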